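(* Consider, on one element of a one-dimensional mesh, the hybrid FV/DGSEM discretization of the visco-resistive GLM-MHD equations $$J\omega_j\dot{\mathbf u}_j=(1-\alpha)\mathbf F_j^{a,\mathrm{DG}}+\alpha\,\mathbf F_j^{a,\mathrm{FV}}-\mathbf F_j^{\nu,\mathrm{DG}},\qquad j=0,\dots,N,$$ with element-local blending coefficient $\alpha\in[0,1]$ and with $\mathbf F_j^{a,\mathrm{DG}}$, $\mathbf F_j^{a,\mathrm{FV}}$, $\mathbf F_j^{\nu,\mathrm{DG}}$ as defined in the context. The entropy balance within the element is $$\sum_{j=0}^NJ\omega_j\dot S_j=\hat f^S_{(0,L)}-\hat f^S_{(N,R)}+\tfrac12\left(r_{(L,0)}+r_{(N,R)}\right)+(1-\alpha)\sum_{j,k=0}^NQ_{jk}\,r^{\mathrm{DG}}_{(j,k)}+\alpha\sum_{j=0}^{N-1}r^{\mathrm{FV}}_{(j,j+1)}+r^\nu,$$ where $\hat f^S$ and $r$ are the numerical entropy flux and the entropy production associated with the numerical flux $\hat{\mathbf f}^a$ used on the element boundaries, $r^{\mathrm{DG}}$ is the entropy production associated with the volume numerical flux $\mathbf f^*$ of the DGSEM, $r^{\mathrm{FV}}$ is the entropy production associated with the inner subcell flux $\hat{\mathbf f}^{a,\mathrm{FV}}$, and $r^\nu$ is the entropy production due to the diffusive terms.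
   Context: Continuous quantities (one-dimensional GLM-MHD). State $\mathbf u=(\rho,\rho\vec v,\rho E,\vec B,\psi)^T\in\mathbb R^9$ with $\rho,p>0$, where $p=(\gamma-1)\left(\rho E-\tfrac12\rho\|\vec v\|^2-\tfrac1{2\mu_0}\|\vec B\|^2-\tfrac1{2\mu_0}\psi^2\right)$; $\gamma,\mu_0,c_h$ are constants. Advective flux in $x$: $$\mathbf f^a=\begin{pmatrix}\rho v_1\\ \rho v_1^2+p+\tfrac1{\mu_0}(\tfrac12\|\vec B\|^2-B_1^2)\\ \rho v_1v_2-B_1B_2/\mu_0\\ \rho v_1v_3-B_1B_3/\mu_0\\ v_1(\tfrac12\rho\|\vec v\|^2+\tfrac{\gamma p}{\gamma-1})+\tfrac1{\mu_0}(v_1\|\vec B\|^2-B_1(\vec v\cdot\vec B))+\tfrac{c_h}{\mu_0}\psi B_1\\ c_h\psi\\ v_1B_2-v_2B_1\\ v_1B_3-v_3B_1\\ c_hB_1\end{pmatrix}.$$ The non-conservative term is $\boldsymbol\phi^{\mathrm{MHD}}\partial_xB_1+\boldsymbol\phi_1^{\mathrm{GLM}}\partial_x\psi$ with $\boldsymbol\phi^{\mathrm{MHD}}=(0,\mu_0^{-1}\vec B,\mu_0^{-1}\vec v\cdot\vec B,\vec v,0)^T$ and $\boldsymbol\phi_1^{\mathrm{GLM}}=\mu_0^{-1}(0,0,0,0,v_1\psi,0,0,0,v_1)^T$. Entropy $S=-\rho s/(\gamma-1)$, $s=\ln(p\rho^{-\gamma})$; entropy variables $\mathbf v=\partial S/\partial\mathbf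 u$; entropy flux $f^S=v_1S$; entropy flux potential $\Psi=\mathbf v^T\mathbf f^a-f^S+\theta B_1$ with $\theta=\mathbf v^T\boldsymbol\phi^{\mathrm{MHD}}$. (Bold $\mathbf v$ denotes entropy variables, $\vec v=(v_1,v_2,v_3)$ the velocity.) The visco-resistive flux $\mathbf f^\nu$ has components $0$; $\tfrac43\mu_{\mathrm{NS}}\partial_xv_1$; $\mu_{\mathrm{NS}}\partial_xv_2$; $\mu_{\mathrm{NS}}\partial_xv_3$; $\mu_{\mathrm{NS}}(\tfrac43v_1\partial_xv_1+v_2\partial_xv_2+v_3\partial_xv_3)+\kappa\,\partial_x(p/(R\rho))+\tfrac{\mu_{\mathrm R}}{\mu_0^2}(B_2\partial_xB_2+B_3\partial_xB_3)$; $0$; $\tfrac{\mu_{\mathrm R}}{\mu_0}\partial_xB_2$; $\tfrac{\mu_{\mathrm R}}{\mu_0}\partial_xB_3$; $0$, with constants $\mu_{\mathrm{NS}},\mu_{\mathrm R},\kappa\ge0$, $R>0$. It is rewritten as a function $\mathbf f^\nu(\mathbf u,\mathbf g)$ of $\mathbf u$ and of the gradient $\mathbf g=\partial_x\mathbf v$ of the entropy variables. Discrete setting. $\xi_0<\dots<\xi_N$ are the Legendre-Gauss-Lobatto (LGL) nodes on $[-1,1]$ with weights $\omega_j$ and Lagrange polynomials $\ell_k$; $Q_{jk}=\omega_j\ell_k'(\xi_j)$. It satisfies $Q+Q^T=\mathrm{diag}(-1,0,\dots,0,1)$ and $\sum_kQ_{jk}=0$. $J>0$ is the constant mapping Jacobian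 of the element. Indices $L,R$ denote the outer states across the left and right element boundaries. A subscript $j$ means evaluation at $\mathbf u_j$, and $\dot S_j=\mathbf v_j^T\dot{\mathbf u}_j$. $[\![a]\!]_{(j,k)}=a_k-a_j$, $\{\!\{a\}\!\}_{(j,k)}=\tfrac12(a_j+a_k)$. Two-point numerical fluxes $\mathbf f^*$ (DGSEM volume flux), $\hat{\mathbf f}^a$ (element boundary flux) and $\hat{\mathbf f}^{a,\mathrm{FV}}$ (flux at subcell interfaces inside the element) are functions of two states, each symmetric in its arguments and consistent with $\mathbf f^a$; a subscript $(j,k)$ means evaluation at $(\mathbf u_j,\mathbf u_k)$. Non-conservative terms: $$\boldsymbol\Phi=\boldsymbol\phi^{\mathrm{MHD}}B_1+\boldsymbol\phi_1^{\mathrm{GLM}}\psi,\quad \boldsymbol\Phi^\Diamond_{(j,k)}=\{\!\{B_1\}\!\}_{(j,k)}\boldsymbol\phi^{\mathrm{MHD}}_j+\{\!\{\psi\}\!\}_{(j,k)}\boldsymbol\phi^{\mathrm{GLM}}_{1,j},\quad \boldsymbol\Phi^*_{(j,k)}=\boldsymbol\phi^{\mathrm{MHD}}_jB_{1,k}+\boldsymbol\phi^{\mathrm{GLM}}_{1,j}\psi_k.$$ DGSEM advective part: $$\mathbf F_j^{a,\mathrm{DG}}=-2\sum_{k=0}^NQ_{jk}\mathbf f^*_{(j,k)}-\sum_{k=0}^NQ_{jk}\boldsymbol\Phi^*_{(j,k)}+\delta_{jN}(\mathbf f^a_N+\boldsymbol\Phi_N)-\delta_{j0}(\mathbf f^a_0+\boldsymbol\Phi_0)-\delta_{jN}(\hat{\mathbf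 f}^a_{(N,R)}+\boldsymbol\Phi^\Diamond_{(N,R)})+\delta_{j0}(\hat{\mathbf f}^a_{(0,L)}+\boldsymbol\Phi^\Diamond_{(0,L)}).$$ Native LGL finite volume part: $$\mathbf F_j^{a,\mathrm{FV}}=\delta_{j0}(\hat{\mathbf f}^a_{(0,L)}+\boldsymbol\Phi^\Diamond_{(0,L)})-\delta_{jN}(\hat{\mathbf f}^a_{(N,R)}+\boldsymbol\Phi^\Diamond_{(N,R)})+(1-\delta_{j0})(\hat{\mathbf f}^{a,\mathrm{FV}}_{(j,j-1)}+\boldsymbol\Phi^\Diamond_{(j,j-1)})-(1-\delta_{jN})(\hat{\mathbf f}^{a,\mathrm{FV}}_{(j,j+1)}+\boldsymbol\Phi^\Diamond_{(j,j+1)}).$$ DGSEM diffusive part: $$\mathbf F_j^{\nu,\mathrm{DG}}=-\sum_{k=0}^NQ_{jk}\mathbf f^\nu_k-\delta_{jN}(\hat{\mathbf f}^\nu_{(N,R)}-\mathbf f^\nu_N)+\delta_{j0}(\hat{\mathbf f}^\nu_{(0,L)}-\mathbf f^\nu_0),\qquad \mathbf f^\nu_k=\mathbf f^\nu(\mathbf u_k,\mathbf g_k),$$ $$J\omega_k\mathbf g_k=\sum_{n=0}^NQ_{kn}\mathbf v_n+\delta_{kN}(\hat{\mathbf v}_{(N,R)}-\mathbf v_N)-\delta_{k0}(\hat{\mathbf v}_{(0,L)}-\mathbf v_0),$$ where $\hat{\mathbf v}$ and $\hat{\mathbf f}^\nu$ are the BR1 (arithmetic mean) interface values. For a numerical flux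 $\mathbf h\in\{\hat{\mathbf f}^a,\mathbf f^*,\hat{\mathbf f}^{a,\mathrm{FV}}\}$ the associated entropy production is $$r_{(j,k)}=[\![\mathbf v]\!]^T_{(j,k)}\mathbf h_{(j,k)}+\mathbf v_k^T\boldsymbol\Phi^\Diamond_{(k,j)}-\mathbf v_j^T\boldsymbol\Phi^\Diamond_{(j,k)}-[\![\Psi]\!]_{(j,k)},$$ denoted $r,r^{\mathrm{DG}},r^{\mathrm{FV}}$ respectively. The numerical entropy flux is $\hat f^S_{(j,k)}=\{\!\{\mathbf v\}\!\}^T_{(j,k)}\hat{\mathbf f}^a_{(j,k)}+\tfrac12\mathbf v_j^T\boldsymbol\Phi^\Diamond_{(j,k)}+\tfrac12\mathbf v_k^T\boldsymbol\Phi^\Diamond_{(k,j)}-\{\!\{\Psi\}\!\}_{(j,k)}$. The diffusive contribution is $r^\nu=-\sum_{j=0}^N\mathbf v_j^T\mathbf F_j^{\nu,\mathrm{DG}}$. *)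

(* Defs.v *)
From mathcomp Require Import all_boot all_order all_algebra.
From mathcomp Require Import all_classical all_reals all_analysis.
Set Implicit Arguments.
Unset Strict Implicit.
Unset Printing Implicit Defensive.
Import Order.TTheory GRing.Theory Num.Theory.
Import numFieldNormedType.Exports.
Local Open Scope classical_set_scope.
Local Open Scope ring_scope.

Record mhdParams (R : realType) := MhdParams {
  gam : R;     (* heat capacity ratio *)
  mu0 : R;     (* permeability of the medium *)
  ch : R;      (* divergence-cleaning wave speed *)
  muNS : R;    (* fluid viscosity *)
  muR : R;     (* resistivity *)
  kappa : R;   (* heat conductivity *)
  Rgas : R     (* gas constant *)
}.

(* [gam != 1] and [mu0 != 0] only say that the quotients below are meaningful;
   the physical regime is [1 < gam] and [0 < mu0]. *)
Definition wfParams (R : realType) (c : mhdParams R) : Prop :=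
  [/\ gam c != 1, mu0 c != 0, 0 < Rgas c
    & [/\ 0 <= muNS c, 0 <= muR c & 0 <= kappa c]].

Section Continuous.
Variables (R : realType) (c : mhdParams R).

(* u = (rho, rho v1, rho v2, rho v3, rho E, B1, B2, B3, psi); the numerals
   below are elements of 'I_9. *)
Definition state := 'rV[R]_9.
Implicit Types u w g : state.

Definition rho u : R := u 0 0.
Definition vel1 u : R := u 0 1 / rho u.
Definition vel2 u : R := u 0 2 / rho u.
Definition vel3 u : R := u 0 3 / rho u.
Definition rhoE u : R := u 0 4.
Definition mag1 u : R := u 0 5.
Definition mag2 u : R := u 0 6.
Definition mag3 u : R := u 0 7.
Definition psi u : R := u 0 8.

Definition dot u w : R := \sum_i u 0 i * w 0 i.

Definition velSq u := vel1 u ^+ 2 + vel2 u ^+ 2 + vel3 u ^+ 2.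
Definition magSq u := mag1 u ^+ 2 + mag2 u ^+ 2 + mag3 u ^+ 2.
Definition velMag u := vel1 u * mag1 u + vel2 u * mag2 u + vel3 u * mag3 u.

Definition pressure u : R :=
  (gam c - 1) * (rhoE u - 2^-1 * rho u * velSq u
                 - (2 * mu0 c)^-1 * magSq u - (2 * mu0 c)^-1 * psi u ^+ 2).

Definition admissible u : Prop := 0 < rho u /\ 0 < pressure u.

Definition advFlux u : state :=
  \row_(i < 9) [::
    rho u * vel1 u;
    rho u * vel1 u ^+ 2 + pressure u
      + (mu0 c)^-1 * (2^-1 * magSq u - mag1 u ^+ 2);
    rho u * vel1 u * vel2 u - mag1 u * mag2 u / mu0 c;
    rho u * vel1 u * vel3 u - mag1 u * mag3 u / mu0 c;
    vel1 u * (2^-1 * rho u * velSq u + gam c * pressure u / (gam c - 1))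
      + (mu0 c)^-1 * (vel1 u * magSq u - mag1 u * velMag u)
      + ch c / mu0 c * psi u * mag1 u;
    ch c * psi u;
    vel1 u * mag2 u - vel2 u * mag1 u;
    vel1 u * mag3 u - vel3 u * mag1 u;
    ch c * mag1 u]`_i.

Definition phiMHD u : state :=
  \row_(i < 9) [::
    0;
    (mu0 c)^-1 * mag1 u; (mu0 c)^-1 * mag2 u; (mu0 c)^-1 * mag3 u;
    (mu0 c)^-1 * velMag u;
    vel1 u; vel2 u; vel3 u;
    0]`_i.

Definition phiGLM u : state :=
  (mu0 c)^-1 *: \row_(i < 9) [::
    0; 0; 0; 0; vel1 u * psi u; 0; 0; 0; vel1 u]`_i.

Definition physEntropy u : R := ln (pressure u * rho u `^ (- gam c)).
Definition mathEntropy u : R := - (rho u * physEntropy u) / (gam c - 1).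

Definition entropyVars u : state :=
  \row_(i < 9) 'D_(delta_mx 0 i) mathEntropy u.

Definition entropyFlux u : R := vel1 u * mathEntropy u.
Definition theta u : R := dot (entropyVars u) (phiMHD u).
Definition entropyPotential u : R :=
  dot (entropyVars u) (advFlux u) - entropyFlux u + theta u * mag1 u.

(* The visco-resistive flux as a function of the state and of the gradient g
   of the entropy variables.  By the chain rule g = ux *m 'J entropyVars u,
   where ux is the gradient of the state; the Jacobian is invertible on
   admissible states, so ux is recovered from g, and the gradient of any
   function q of the state is then its derivative at u in the direction ux. *)
Definition stateGrad u g : state := g *m invmx ('J entropyVars u).

Definition viscFlux u g : state :=
  let dx (q : state -> R) : R := 'D_(stateGrad u g) q u in
  \row_(i < 9) [::
    0;
    4 / 3 * muNS c * dx vel1;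
    muNS c * dx vel2;
    muNS c * dx vel3;
    muNS c * (4 / 3 * vel1 u * dx vel1 + vel2 u * dx vel2 + vel3 u * dx vel3)
      + kappa c * dx (fun w => pressure w / (Rgas c * rho w))
      + muR c / mu0 c ^+ 2 * (mag2 u * dx mag2 + mag3 u * dx mag3);
    0;
    muR c / mu0 c * dx mag2;
    muR c / mu0 c * dx mag3;
    0]`_i.

End Continuous.

Section LegendreGaussLobatto.
Variable R : realType.

(* Rodrigues' formula *)
Definition legendre (n : nat) : {poly R} :=
  (2 ^+ n * n`!%:R)^-1 *: (('X^2 - 1) ^+ n)^`(n).

(* For 1 <= N the polynomial (1 - x^2) P_N'(x) has exactly N+1 roots, all simple
   and in [-1, 1]; xi lists them in increasing order. Only xi 0, ..., xi N
   matter (nat indices are what [lagrange] expects). *)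
Definition lglNodes (N : nat) (xi : nat -> R) : Prop :=
  (forall i j : nat, (i < j <= N)%N -> xi i < xi j) /\
  (forall j : nat, (j <= N)%N ->
    root ((1 - 'X^2) * deriv (legendre N)) (xi j)).

Variables (N : nat) (xi : nat -> R).

Definition lagrangePoly (k : 'I_N.+1) : {poly R} := tnth (lagrange N.+1 xi) k.

Definition lglWeight (j : 'I_N.+1) : R :=
  \int[lebesgue_measure]_(x in `[-1, 1]) (lagrangePoly j).[x].

Definition Qmx (j k : 'I_N.+1) : R :=
  lglWeight j * (deriv (lagrangePoly k)).[xi j].

End LegendreGaussLobatto.

Section TwoPoint.
Variables (R : realType) (c : mhdParams R).
Implicit Types (a b : state R) (h : state R -> state R -> state R).

Definition symmetricFlux h : Prop :=
  forall a b, admissible c a -> admissible c b -> h a b = h b a.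
Definition consistentFlux h : Prop :=
  forall a, admissible c a -> h a a = advFlux c a.

Definition Phi a : state R := mag1 a *: phiMHD c a + psi a *: phiGLM c a.
Definition PhiDiamond a b : state R :=
  (2^-1 * (mag1 a + mag1 b)) *: phiMHD c a
  + (2^-1 * (psi a + psi b)) *: phiGLM c a.
Definition PhiStar a b : state R := mag1 b *: phiMHD c a + psi b *: phiGLM c a.

Definition entropyProd h a b : R :=
  dot (entropyVars c b - entropyVars c a) (h a b)
  + dot (entropyVars c b) (PhiDiamond b a)
  - dot (entropyVars c a) (PhiDiamond a b)
  - (entropyPotential c b - entropyPotential c a).

Definition numEntropyFlux h a b : R :=
  dot (2^-1 *: (entropyVars c a + entropyVars c b)) (h a b)
  + 2^-1 * dot (entropyVars c a) (PhiDiamond a b)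
  + 2^-1 * dot (entropyVars c b) (PhiDiamond b a)
  - 2^-1 * (entropyPotential c a + entropyPotential c b).

End TwoPoint.

Section Discretization.
Variables (R : realType) (c : mhdParams R) (N : nat) (xi : nat -> R).
Implicit Types (u g : 'I_N.+1 -> state R) (uL uR gL gR : state R).
Implicit Types (fstar fhat ffv : state R -> state R -> state R).
Implicit Types j k : 'I_N.+1.

Local Notation Q := (@Qmx R N xi).
Local Notation delta0 j := ((j == ord0)%:R : R).
Local Notation deltaN j := ((j == ord_max)%:R : R).

Definition advDG fstar fhat u uL uR j : state R :=
  - (2 *: \sum_k Q j k *: fstar (u j) (u k))
  - \sum_k Q j k *: PhiStar c (u j) (u k)
  + deltaN j *: (advFlux c (u ord_max) + Phi c (u ord_max))
  - delta0 j *: (advFlux c (u ord0) + Phi c (u ord0))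
  - deltaN j *: (fhat (u ord_max) uR + PhiDiamond c (u ord_max) uR)
  + delta0 j *: (fhat (u ord0) uL + PhiDiamond c (u ord0) uL).

(* [inord j.-1] and [inord j.+1] are the neighbours of j whenever they are not
   multiplied by 0. *)
Definition advFV ffv fhat u uL uR j : state R :=
  delta0 j *: (fhat (u ord0) uL + PhiDiamond c (u ord0) uL)
  - deltaN j *: (fhat (u ord_max) uR + PhiDiamond c (u ord_max) uR)
  + (1 - delta0 j) *: (ffv (u j) (u (inord j.-1))
                       + PhiDiamond c (u j) (u (inord j.-1)))
  - (1 - deltaN j) *: (ffv (u j) (u (inord j.+1))
                       + PhiDiamond c (u j) (u (inord j.+1))).

(* BR1 interface value *)
Definition br1 (a b : state R) : state R := 2^-1 *: (a + b).

(* g is the BR1 gradient of the entropy variables. *)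
Definition isGradient (J : R) u uL uR g : Prop :=
  forall k, (J * lglWeight xi k) *: g k =
    \sum_n Q k n *: entropyVars c (u n)
    + deltaN k *: (br1 (entropyVars c (u ord_max)) (entropyVars c uR)
                   - entropyVars c (u ord_max))
    - delta0 k *: (br1 (entropyVars c (u ord0)) (entropyVars c uL)
                   - entropyVars c (u ord0)).

(* gL and gR are the gradients that the neighbouring elements attach to the
   outer states uL and uR. *)
Definition diffDG u g uL gL uR gR j : state R :=
  - \sum_k Q j k *: viscFlux c (u k) (g k)
  - deltaN j *: (br1 (viscFlux c (u ord_max) (g ord_max)) (viscFlux c uR gR)
                 - viscFlux c (u ord_max) (g ord_max))
  + delta0 j *: (br1 (viscFlux c (u ord0) (g ord0)) (viscFlux c uL gL)
                 - viscFlux c (u ord0) (g ord0)).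

Definition diffEntropyProd u g uL gL uR gR : R :=
  - \sum_j dot (entropyVars c (u j)) (diffDG u g uL gL uR gR j).

End Discretization.

(* Main.v *)
Require Import Defs.
From mathcomp Require Import all_boot all_order all_algebra.
From mathcomp Require Import all_classical all_reals all_analysis.
From mathcomp Require Import ring lra zify polyrcf.
(* The volume terms are handled by the summation-by-parts property
   Q + Q^T = diag(-1, 0, ..., 0, 1) and the zero row sums of Q.  These hold
   because the Lobatto rule is exact up to degree 2N - 1: (1 - x^2) P_N' is
   orthogonal to all polynomials of degree at most N - 2 (integrate Rodrigues'
   formula by parts), so the integral of (l_j l_k)' can be computed both by the
   quadrature and from the end points.  Contracting the DG volume term with the
   entropy variables then leaves the productions r^DG and the boundary
   difference of the potentials Psi; the finite volume term telescopes to the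
   productions r^FV and the same difference of Psi, which the half-productions
   and entropy fluxes of the element boundaries absorb. *)

Set Implicit Arguments.
Unset Strict Implicit.
Unset Printing Implicit Defensive.
Import Order.TTheory GRing.Theory Num.Theory.
Import numFieldNormedType.Exports.
Local Open Scope classical_set_scope.
Local Open Scope ring_scope.

(** * Integration of polynomials over [-1, 1] *)

Section PolynomialIntegral.
Variable R : realType.
Implicit Types (p q s : {poly R}) (a b : R).

Definition pintegral p : R := \int[lebesgue_measure]_(x in `[-1, 1]) p.[x].

Lemma pintegral_deriv p : pintegral p^`() = p.[1] - p.[-1].
Proof.
rewrite /pintegral /Rintegral (@continuous_FTC2 _ _ (horner p)) //=.
- exact/continuous_subspaceT/continuous_horner.
- split=> [x _||]; first exact: derivable_horner.
  + exact/cvg_at_right_filter/continuous_horner.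
  + exact/cvg_at_left_filter/continuous_horner.
- by move=> x _; rewrite derive1E derive_val.
Qed.

(** With [pintegral_deriv], this turns every integral into a difference of end-point values, so
    linearity needs no integrability argument. *)
Lemma antiderivative p : exists q, q^`() = p.
Proof.
exists (\poly_(i < (size p).+1) (p`_i.-1 / i%:R)).
apply/polyP => i; rewrite coef_deriv coef_poly ltnS.
case: ltnP => [_|le_pi].
  by rewrite -[LHS]mulr_natr mulfVK // pnatr_eq0.
by rewrite nth_default // mul0rn.
Qed.

Lemma pintegralD p q : pintegral (p + q) = pintegral p + pintegral q.
Proof.
have [[P <-] [Q <-]] := (antiderivative p, antiderivative q).
by rewrite -derivD !pintegral_deriv !hornerD opprD addrACA.
Qed.

Lemma pintegralZ a p : pintegral (a *: p) = a * pintegral p.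
Proof.
have [P <-] := antiderivative p.
by rewrite -derivZ !pintegral_deriv !hornerZ mulrBr.
Qed.

Lemma pintegral_sum (I : finType) (F : I -> {poly R}) :
  pintegral (\sum_i F i) = \sum_i pintegral (F i).
Proof.
apply: (big_morph pintegral pintegralD).
by rewrite -[0](scale0r 0) pintegralZ mul0r.
Qed.

Lemma pintegral_by_parts p q :
  pintegral (p^`() * q) =
    (p * q).[1] - (p * q).[-1] - pintegral (p * q^`()).
Proof. by rewrite -pintegral_deriv derivM pintegralD addrK. Qed.

Lemma poly_eq0_itv p : (forall x : R, -1 <= x <= 1 -> p.[x] = 0) -> p = 0.
Proof.
move=> p0; apply/eqP/negPn/negP => p_neq0.
(* The points 1/(i+1) are distinct, lie in (0, 1], and number [size p], one more than the roots a
   nonzero [p] can have. *)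
pose rs := [seq (i.+1%:R)^-1 : R | i <- iota 0 (size p)].
have /(max_poly_roots p_neq0) : all (root p) rs.
  apply/allP => _ /mapP[i _ ->]; apply/rootP/p0.
  have i_gt0 : 0 < i.+1%:R :> R by rewrite ltr0n.
  rewrite invf_le1 // ler1n andbT.
  by rewrite (le_trans _ (ltW (_ : 0 < _))) ?invr_gt0 // lerN10.
suff /[swap]/[apply] : uniq rs by rewrite size_map size_iota ltnn.
rewrite map_inj_uniq ?iota_uniq // => i j /invr_inj /eqP.
by rewrite eqr_nat eqSS => /eqP.
Qed.

(** An antiderivative is nondecreasing on [-1, 1] and takes equal values at the ends, hence is
    constant there, and so constant as a polynomial. *)
Lemma pintegral_eq0 p :
  (forall x : R, -1 <= x <= 1 -> 0 <= p.[x]) -> pintegral p = 0 -> p = 0.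
Proof.
have [P <-] := antiderivative p => P_ge0.
rewrite pintegral_deriv => /eqP; rewrite subr_eq0 => /eqP P1.
have mono x y : -1 <= x -> x <= y -> y <= 1 -> P.[x] <= P.[y].
  move=> x1 xy y1; apply: (@ler_hornerW _ (-1) 1) => //.
  - by move=> z; rewrite in_itv /= => /andP[z1 z2]; apply: P_ge0; rewrite !ltW.
  - by rewrite in_itv /= x1 (le_trans xy).
  - by rewrite in_itv /= y1 (le_trans x1).
suff -> : P = P.[1]%:P by rewrite derivC.
apply/eqP; rewrite -subr_eq0; apply/eqP/poly_eq0_itv => x /andP[x1 x2].
rewrite !hornerE; apply/eqP; rewrite subr_eq0 eq_le mono //=.
by rewrite P1 mono.
Qed.

End PolynomialIntegral.

(** * Orthogonality of the Legendre and Lobatto polynomials *)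

Section Legendre.
Variable R : realType.
Implicit Types (p q s t : {poly R}).

Lemma dvdp_exp_deriv q p k : q ^+ k.+1 %| p -> q ^+ k %| p^`().
Proof.
move=> /dvdpP[s ->]; rewrite derivM deriv_exp /=.
rewrite dvdp_add //; first by rewrite exprS mulrA dvdp_mull.
by rewrite mulrnAr -mulrnAl !dvdp_mull.
Qed.

Lemma dvdp_exp_derivn q p k m : (m <= k)%N -> q ^+ k %| p ->
  q ^+ (k - m) %| p^`(m).
Proof.
elim: m => [|m IHm] lemk; first by rewrite subn0.
move=> /(IHm (ltnW lemk)) dvd; rewrite derivnS; apply: dvdp_exp_deriv.
by rewrite -subSn.
Qed.

(** Each derivative costs at most one factor X^2 - 1, so at least one survives. *)
Lemma rodrigues_boundary N m (x : R) : x ^+ 2 = 1 -> (m < N)%N ->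
  (('X^2 - 1) ^+ N)^`(m).[x] = 0.
Proof.
move=> x2 ltmN.
have := dvdp_exp_derivn (ltnW ltmN) (dvdpp (('X^2 - 1 : {poly R}) ^+ N)).
move=> /dvdpP[s ->]; rewrite hornerM horner_exp !hornerE x2 subrr.
by rewrite expr0n subn_eq0 leqNgt ltmN mulr0.
Qed.

(** Each integration by parts moves one derivative onto [t], with vanishing boundary terms; the
    degree bound makes [t] zero once [m] reaches 0. *)
Lemma rodrigues_orthogonal N m t : (m <= N)%N -> (size t <= m)%N ->
  pintegral ((('X^2 - 1) ^+ N)^`(m) * t) = 0.
Proof.
elim: m t => [|m IHm] t lemN.
  rewrite leqn0 size_poly_eq0 => /eqP->; rewrite mulr0.
  by rewrite -[0](scale0r 0) pintegralZ mul0r.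
move=> sz_t; rewrite derivnS pintegral_by_parts !hornerM.
rewrite !rodrigues_boundary ?expr1n ?sqrrN ?expr1n // !mul0r subrr.
rewrite IHm ?subr0 ?(ltnW lemN) //.
have [->|t0] := eqVneq t 0; first by rewrite deriv0 size_poly0.
by rewrite -ltnS (leq_trans (lt_size_deriv t0)).
Qed.

Lemma legendre_orthogonal N t : (size t <= N)%N ->
  pintegral (legendre R N * t) = 0.
Proof.
by move=> ?; rewrite /legendre -scalerAl pintegralZ rodrigues_orthogonal ?mulr0.
Qed.

(** For [0 < N], a scalar multiple of the nodal polynomial of the LGL nodes. *)
Definition lobattoPoly N : {poly R} := (1 - 'X^2) * (legendre R N)^`().

Lemma size_legendre N : (size (legendre R N) <= N.+1)%N.
Proof.
rewrite /legendre; apply: leq_trans (size_scale_leq _ _) _.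
apply/leq_sizeP => j leNj; rewrite coef_derivn nth_default ?mul0rn //.
apply: leq_trans (size_poly_exp_leq _ _) _.
rewrite size_XnsubC //=; lia.
Qed.

Lemma deriv_legendre_neq0 N : (0 < N)%N -> (legendre R N)^`() != 0.
Proof.
(* The coefficient of X^(N-1) comes from the leading term X^(2N) of (X^2 - 1)^N after N + 1
   derivatives. *)
move=> N0; apply/eqP => /polyP/(_ N.-1)/eqP.
rewrite /legendre derivZ -derivnS coefZ coef_derivn coef0.
have <- : (N * 2)%N = (N.+1 + N.-1)%N by lia.
have -> : (('X^2 - 1) ^+ N)`_(N * 2) = 1 :> R.
  have mon : ('X^2 - 1 : {poly R}) \is monic by exact: monicXnsubC.
  have /monicP := monic_exp N mon.
  by rewrite lead_coefE size_exp size_XnsubC //= mulnC.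
apply/negP; rewrite !mulf_neq0 ?invr_neq0 ?mulf_neq0 ?expf_neq0 ?pnatr_eq0 //.
  by rewrite -lt0n fact_gt0.
rewrite -lt0n ffact_gt0; lia.
Qed.

Lemma lobattoPoly_neq0 N : (0 < N)%N -> lobattoPoly N != 0.
Proof.
move=> N0; rewrite mulf_neq0 ?deriv_legendre_neq0 //.
by rewrite -opprB oppr_eq0 -size_poly_gt0 size_XnsubC.
Qed.

Lemma size_lobattoPoly_leq N : (size (lobattoPoly N) <= N.+2)%N.
Proof.
have sz2 : size (1 - 'X^2 : {poly R}) = 3.
  by rewrite -opprB size_polyN size_XnsubC.
have [->|P0] := eqVneq (lobattoPoly N) 0; first by rewrite size_poly0.
apply: leq_trans (size_polyMleq _ _) _; rewrite sz2 /= !addSn /= add0n !ltnS.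
have [->|L0] := eqVneq (legendre R N) 0; first by rewrite deriv0 size_poly0.
by rewrite -ltnS (leq_trans (lt_size_deriv L0)) ?size_legendre.
Qed.

(** Integrate P_N' against (1 - X^2) s by parts: 1 - x^2 kills the boundary terms, and the
    derivative of (1 - X^2) s has degree below N, so it is orthogonal to P_N. *)
Lemma lobattoPoly_orthogonal N s : (size s < N)%N ->
  pintegral (lobattoPoly N * s) = 0.
Proof.
move=> sz_s; rewrite /lobattoPoly mulrAC mulrC pintegral_by_parts.
rewrite !hornerM !hornerE /= legendre_orthogonal ?subr0; last first.
  have [->|s0] := eqVneq s 0; first by rewrite mulr0 deriv0 size_poly0.
  have st0 : (1 - 'X^2) * s != 0.
    by rewrite mulf_neq0 // -opprB oppr_eq0 -size_poly_gt0 size_XnsubC.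
  rewrite -ltnS (leq_trans (lt_size_deriv st0)) //.
  apply: leq_trans (size_polyMleq _ _) _.
  by rewrite -opprB size_polyN size_XnsubC.
ring.
Qed.

End Legendre.

(** * Lobatto nodes, exactness of the quadrature, and the properties of Q *)

Section LobattoQuadrature.
Variables (R : realType) (N : nat) (xi : nat -> R).
Hypothesis (N_gt0 : (0 < N)%N) (hxi : lglNodes N xi).
Implicit Types (p q : {poly R}) (i j k : 'I_N.+1).

Local Notation L := (lagrangePoly xi).

(* The Lagrange basis of [qpoly] is studied for node sequences that are
   injective on all of [nat]; only the first [N.+1] nodes enter its
   definition. *)
Lemma lagrange_extension : exists2 y : nat -> R,
  injective y &
  forall k : 'I_N.+1, xi k = y k /\ L k = tnth (lagrange N.+1 y) k.
Proof.
have [xi_lt _] := hxi.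
(* Continuing to the right of [xi N] keeps the sequence strictly increasing, hence injective. *)
pose y (i : nat) := if (i <= N)%N then xi i else xi N + i%:R.
have xiN (i : nat) : (i <= N)%N -> xi i <= xi N.
  rewrite leq_eqVlt => /predU1P[->//|ltiN]; apply/ltW/xi_lt.
  by rewrite ltiN leqnn.
have y_lt (i j : nat) : (i < j)%N -> y i < y j.
  move=> ltij; rewrite /y; case: (leqP j N) => [leqjN|ltNj].
    by rewrite (leq_trans (ltnW ltij)) // xi_lt // ltij.
  case: leqP => [leqiN|_]; last by rewrite ltrD2l ltr_nat.
  by rewrite (le_lt_trans (xiN _ leqiN)) // ltrDl ltr0n (leq_trans _ ltNj).
have yE (i : 'I_N.+1) : y i = xi i by rewrite /y -ltnS ltn_ord.
exists y => [i j yij|k].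
  by case: (ltngtP i j) => // /y_lt; rewrite yij ltxx.
split=> //; rewrite /lagrangePoly /lagrange !locked_withE !tnth_map.
rewrite tnth_ord_tuple /=.
by rewrite yE; under [in RHS]eq_bigr do rewrite yE.
Qed.

Lemma lagrangePoly_sample j k : (L j).[xi k] = (j == k)%:R.
Proof.
have [y y_inj yE] := lagrange_extension.
by rewrite (yE k).1 (yE j).2 lagrange_sample.
Qed.

Lemma size_lagrangePoly j : size (L j) = N.+1.
Proof.
have [y y_inj yE] := lagrange_extension.
by rewrite (yE j).2 size_lagrange_.
Qed.

Lemma lagrangePoly_gen p : (size p <= N.+1)%N ->
  p = \sum_(j < N.+1) p.[xi j] *: L j.
Proof.
have [y y_inj yE] := lagrange_extension => sz_p.
rewrite [LHS](lagrange_gen _ y_inj sz_p) //; apply: eq_bigr => j _.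
by rewrite mul_polyC (yE j).1 (yE j).2.
Qed.

Lemma node_lobatto (j : 'I_N.+1) : root (lobattoPoly R N) (xi j).
Proof. by apply: hxi.2; rewrite -ltnS. Qed.

Lemma nodes_uniq : uniq [seq xi (val j) | j <- enum 'I_N.+1].
Proof.
rewrite map_inj_uniq ?enum_uniq // => i j.
by have [y y_inj yE] := lagrange_extension; rewrite !(yE _).1 => /y_inj/val_inj.
Qed.

(** The N + 1 distinct nodes are roots, which bounds the degree from below. *)
Lemma size_lobattoPoly : size (lobattoPoly R N) = N.+2.
Proof.
apply/anti_leq; rewrite size_lobattoPoly_leq /=.
have := max_poly_roots (lobattoPoly_neq0 R N_gt0) _ nodes_uniq.
rewrite size_map size_enum_ord; apply; apply/allP => _ /mapP[j _ ->].
exact: node_lobatto.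
Qed.

(** A further root would make N + 2 of them, more than the degree N + 1 allows. *)
Lemma root_lobatto_node (x : R) : root (lobattoPoly R N) x ->
  exists j : 'I_N.+1, x = xi j.
Proof.
move=> rx; suff /mapP[j _ ->] : x \in [seq xi (val j) | j <- enum 'I_N.+1].
  by exists j.
apply/negPn/negP => nx.
have := max_poly_roots (rs := x :: [seq xi (val j) | j <- enum 'I_N.+1])
  (lobattoPoly_neq0 R N_gt0) _ _.
rewrite /= nx nodes_uniq rx size_map size_enum_ord size_lobattoPoly ltnn.
suff all_roots : all (root (lobattoPoly R N))
    [seq xi (val j) | j <- enum 'I_N.+1].
  by move=> /(_ all_roots isT).
by apply/allP => _ /mapP[j _ ->]; exact: node_lobatto.
Qed.

(* A node r outside [-1, 1] would be a root of P_N', so that lobattoPoly =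
   (1 - x^2) (x - r) q with deg q <= N - 2; testing against - r q gives the
   integral of (1 - x^2) (r^2 - r x) q^2, positive although it must vanish. *)
Lemma node_bounded (j : 'I_N.+1) : `|xi j| <= 1.
Proof.
rewrite leNgt; apply/negP => r_gt1; set r := xi j in r_gt1.
have := node_lobatto j; rewrite -/r /lobattoPoly rootM => /orP[|].
  rewrite /root !hornerE subr_eq0 eq_sym -(real_normK (num_real r)) => /eqP r2.
  nra.
move=> /factor_theorem[q Pq].
have W0 := lobattoPoly_neq0 R N_gt0.
have q0 : q != 0.
  by apply: contraNneq W0 => q0; rewrite /lobattoPoly Pq q0 mul0r mulr0.
have sz_q : (size q < N)%N.
  have := size_lobattoPoly; rewrite /lobattoPoly Pq.
  rewrite !size_mul ?mulf_neq0 ?polyXsubC_eq0 //; last first.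
    by rewrite -opprB oppr_eq0 -size_poly_gt0 size_XnsubC.
  have -> : size ('X - r%:P) = 2%N by exact: size_XsubC.
  rewrite -opprB size_polyN size_XnsubC // addn2 => -[<-].
  exact: ltnSn.
have r0 : r != 0 by rewrite -normr_gt0; lra.
have /pintegral_eq0 : forall x : R, -1 <= x <= 1 ->
    0 <= (lobattoPoly R N * (- r *: q)).[x].
  move=> x /andP[x1 x2].
  have -> : (lobattoPoly R N * (- r *: q)).[x]
     = (1 - x ^+ 2) * (r ^+ 2 - r * x) * q.[x] ^+ 2.
    by rewrite /lobattoPoly Pq !hornerE /=; ring.
  apply: mulr_ge0 (sqr_ge0 _); apply: mulr_ge0; first nra.
  have : `|x| <= 1 by rewrite ler_norml x1.
  rewrite subr_ge0 => x_le1; apply: le_trans (ler_norm _) _.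
  rewrite normrM -(real_normK (num_real r)) expr2.
  by rewrite ler_wpM2l // (le_trans x_le1) // ltW.
rewrite lobattoPoly_orthogonal; last first.
  by rewrite (leq_ltn_trans (size_scale_leq _ _)).
move=> /(_ erefl) /eqP.
by rewrite mulf_eq0 (negPf W0) scaler_eq0 oppr_eq0 (negPf r0) (negPf q0).
Qed.

Lemma lobatto_endpoint (x : R) : x ^+ 2 = 1 -> exists j : 'I_N.+1, x = xi j.
Proof.
move=> x2; apply: root_lobatto_node.
by rewrite /root /lobattoPoly !hornerE x2 subrr mul0r.
Qed.

Lemma node_mono i j : (i <= j)%N -> xi i <= xi j.
Proof.
rewrite leq_eqVlt => /predU1P[/val_inj->//|ltij].
by apply/ltW/hxi.1; rewrite ltij -ltnS ltn_ord.
Qed.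

(** The point -1 is a node because it is a root of 1 - X^2, and no node lies below it. *)
Lemma node_first : xi (@ord0 N) = -1.
Proof.
have [|j x1] := @lobatto_endpoint (-1); first by rewrite sqrrN expr1n.
apply/eqP; rewrite eq_le; apply/andP; split.
  by rewrite [leRHS]x1 node_mono.
by have := node_bounded ord0; rewrite ler_norml => /andP[].
Qed.

Lemma node_last : xi (@ord_max N) = 1.
Proof.
have [|j x1] := @lobatto_endpoint 1; first by rewrite expr1n.
apply/eqP; rewrite eq_le; apply/andP; split.
  by have := node_bounded ord_max; rewrite ler_norml => /andP[].
by rewrite [leLHS]x1 node_mono // -ltnS ltn_ord.
Qed.

(** Divide by [lobattoPoly]: the quotient has degree at most N - 2, so its term integrates to zero;
    the remainder agrees with [p] at the nodes and is interpolated exactly. *)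
Lemma lobatto_quadrature p : (size p <= N.*2)%N ->
  pintegral p = \sum_(j < N.+1) lglWeight xi j * p.[xi j].
Proof.
move=> sz_p; have W0 := lobattoPoly_neq0 R N_gt0.
rewrite [in LHS](divp_eq p (lobattoPoly R N)) pintegralD mulrC.
rewrite lobattoPoly_orthogonal ?add0r; last first.
  rewrite size_divp // size_lobattoPoly /=.
  by move: (size p) sz_p => n; lia.
have sz_r : (size (p %% lobattoPoly R N)%R <= N.+1)%N.
  by rewrite -ltnS -size_lobattoPoly ltn_modp.
rewrite (lagrangePoly_gen sz_r) pintegral_sum; apply: eq_bigr => j _.
rewrite pintegralZ mulrC; congr (_ * _).
have /rootP rj := node_lobatto j.
by rewrite [in RHS](divp_eq p (lobattoPoly R N)) hornerD hornerM rj mulr0 add0r.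
Qed.

Lemma summation_by_parts j k : Qmx xi j k + Qmx xi k j =
  (j == ord_max)%:R * (k == ord_max)%:R - (j == ord0)%:R * (k == ord0)%:R.
Proof.
have sample (w : 'I_N.+1 -> R) i : \sum_n w n * (i == n)%:R = w i.
  rewrite (bigD1 i) //= eqxx mulr1 big1 ?addr0 // => n /negPf.
  by rewrite eq_sym => ->; rewrite mulr0.
have LL0 : L j * L k != 0.
  by rewrite mulf_neq0 // -size_poly_gt0 size_lagrangePoly.
transitivity (pintegral (L j * L k)^`()); last first.
  rewrite -![in RHS]lagrangePoly_sample node_first node_last.
  by rewrite pintegral_deriv !hornerM.
rewrite lobatto_quadrature; last first.
  have := lt_size_deriv LL0; have := size_polyMleq (L j) (L k).
  rewrite !size_lagrangePoly; lia.
(* Since l_j is 1 at its own node and 0 at the others, Q_jk is the quadrature sum of l_j l_k'. *)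
rewrite /Qmx -(sample (fun n => lglWeight xi n * (deriv (L j)).[xi n])).
rewrite -(sample (fun n => lglWeight xi n * (deriv (L k)).[xi n])) derivM.
rewrite -big_split; apply: eq_bigr => n _.
by rewrite !hornerE !lagrangePoly_sample /=; ring.
Qed.

(** The Lagrange polynomials sum to 1, whose derivative is zero. *)
Lemma sum_Qmx_row j : \sum_(k < N.+1) Qmx xi j k = 0.
Proof.
rewrite /Qmx -mulr_sumr -horner_sum -linear_sum.
suff <- : 1 = \sum_(k < N.+1) L k by rewrite -polyC1 /= derivC horner0 mulr0.
rewrite [LHS]lagrangePoly_gen ?size_poly1 //.
by apply: eq_bigr => k _; rewrite hornerC scale1r.
Qed.

End LobattoQuadrature.

(** * Bilinearity of the dot product *)

Section DotProduct.
Variable R : realType.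
Implicit Types (u v w : state R) (a : R).

Lemma dotDr u v w : dot u (v + w) = dot u v + dot u w.
Proof. by rewrite -big_split; apply: eq_bigr => i _; rewrite mxE mulrDr. Qed.

Lemma dotZr a u v : dot u (a *: v) = a * dot u v.
Proof. by rewrite mulr_sumr; apply: eq_bigr => i _; rewrite mxE mulrCA. Qed.

Lemma dotNr u v : dot u (- v) = - dot u v.
Proof. by rewrite -scaleN1r dotZr mulN1r. Qed.

Lemma dotBr u v w : dot u (v - w) = dot u v - dot u w.
Proof. by rewrite dotDr dotNr. Qed.

Lemma dotC u v : dot u v = dot v u.
Proof. by apply: eq_bigr => i _; rewrite mulrC. Qed.

Lemma dotDl u v w : dot (u + v) w = dot u w + dot v w.
Proof. by rewrite dotC dotDr !(dotC w). Qed.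

Lemma dotBl u v w : dot (u - v) w = dot u w - dot v w.
Proof. by rewrite dotC dotBr !(dotC w). Qed.

Lemma dotZl a u v : dot (a *: u) v = a * dot u v.
Proof. by rewrite dotC dotZr dotC. Qed.

Lemma dot_sumr (I : finType) u (F : I -> state R) :
  dot u (\sum_i F i) = \sum_i dot u (F i).
Proof.
apply: (big_morph (dot u) (dotDr u)).
by rewrite -[0](scale0r 0) dotZr mul0r.
Qed.

End DotProduct.

(** * Entropy identities for two-point fluxes and for the volume terms *)

Section EntropyBalance.
Variables (R : realType) (c : mhdParams R).
Implicit Types (a b : state R) (f h : state R -> state R -> state R).

Local Notation ev := (entropyVars c).
Local Notation Psi := (entropyPotential c).

Lemma PhiDiamond_diag a : PhiDiamond c a a = Phi c a.
Proof. by rewrite /PhiDiamond /Phi; congr (_ *: _ + _ *: _); field. Qed.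

(** Both terms evaluate the coefficient vectors at [a]. The identity trades [PhiStar] for
    [PhiDiamond], up to a term in [a] alone. *)
Lemma PhiDiamond_half a b :
  2 *: PhiDiamond c a b = Phi c a + PhiStar c a b.
Proof.
rewrite /PhiDiamond /Phi /PhiStar; move: (phiMHD c a) (phiGLM c a) => V W.
by rewrite scalerDr !scalerA !mulVKf ?pnatr_eq0 // !scalerDl addrACA.
Qed.

(** A value at [a] is the mean minus half the jump: the means form the entropy flux, the half-jumps
    the production. *)
Lemma boundary_entropy_right h a b :
  dot (ev a) (h a b + PhiDiamond c a b) =
    numEntropyFlux c h a b - 2^-1 * entropyProd c h a b + Psi a.
Proof.
rewrite /numEntropyFlux /entropyProd.
move: (ev a) (ev b) (h a b) (PhiDiamond c a b) (PhiDiamond c b a) => v w f P P'.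
by rewrite dotZl !(dotBl, dotDl, dotDr); field.
Qed.

(** Here the element state [a] is the right-hand state of the interface, so the half-jump changes
    sign. *)
Lemma boundary_entropy_left h a b : h a b = h b a ->
  dot (ev a) (h a b + PhiDiamond c a b) =
    numEntropyFlux c h a b + 2^-1 * entropyProd c h b a + Psi a.
Proof.
move=> hC; rewrite /numEntropyFlux /entropyProd -hC.
move: (ev a) (ev b) (h a b) (PhiDiamond c a b) (PhiDiamond c b a) => v w f P P'.
by rewrite dotZl !(dotBl, dotDl, dotDr); field.
Qed.

Lemma entropyProdE h a b : entropyProd c h a b =
  dot (ev b) (h a b) - dot (ev a) (h a b)
  + dot (ev b) (PhiDiamond c b a) - dot (ev a) (PhiDiamond c a b)
  - (Psi b - Psi a).
Proof. by rewrite /entropyProd; move: (ev a) (ev b) => v w; rewrite dotBl. Qed.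

Lemma interface_entropy h a b : h a b = h b a ->
  dot (ev b) (h b a + PhiDiamond c b a) - dot (ev a) (h a b + PhiDiamond c a b)
  = entropyProd c h a b + (Psi b - Psi a).
Proof.
move=> hC; rewrite entropyProdE -hC.
move: (ev a) (ev b) (h a b) (PhiDiamond c a b) (PhiDiamond c b a) => v w f P P'.
by rewrite !dotDr; ring.
Qed.

Lemma sum_pick (N : nat) (i : 'I_N) (F : 'I_N -> R) :
  \sum_j (j == i)%:R * F j = F i.
Proof.
rewrite (bigD1 i) //= eqxx mul1r big1 ?addr0 // => j /negPf->.
by rewrite mul0r.
Qed.

Section DG.
Variables (N : nat) (xi : nat -> R).
Hypothesis (N_gt0 : (0 < N)%N) (hxi : lglNodes N xi).
Local Notation Q := (@Qmx R N xi).

(** Exchanging the indices replaces Q by its transpose, which is -Q plus the two corner entries. *)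
Lemma sum_Qmx_transpose (F : 'I_N.+1 -> 'I_N.+1 -> R) :
  \sum_j \sum_k Q j k * F k j =
    F ord_max ord_max - F ord0 ord0 - \sum_j \sum_k Q j k * F j k.
Proof.
apply: (addIr (\sum_j \sum_k Q j k * F j k)).
rewrite subrK exchange_big -big_split /=.
transitivity (\sum_j \sum_k
   ((j == ord_max)%:R * ((k == ord_max)%:R * F j k) -
    (j == ord0)%:R * ((k == ord0)%:R * F j k))).
  apply: eq_bigr => j _; rewrite -big_split; apply: eq_bigr => k _ /=.
  by rewrite -mulrDl addrC summation_by_parts // mulrBl !mulrA.
under eq_bigr do rewrite sumrB -!mulr_sumr !sum_pick.
by rewrite sumrB !sum_pick.
Qed.

(** Both sides reduce to Q-sums of the flux terms [A] and the non-conservative terms [B].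
    Transposition produces the factor 2 of the scheme; by consistency its corner values are the
    terms in [advFlux] and [Phi]. *)
Lemma DG_volume_entropy f (u : 'I_N.+1 -> state R) :
  (forall j k, f (u j) (u k) = f (u k) (u j)) ->
  (forall j, f (u j) (u j) = advFlux c (u j)) ->
  \sum_j dot (ev (u j)) (- (2 *: \sum_k Q j k *: f (u j) (u k))
     - \sum_k Q j k *: PhiStar c (u j) (u k))
   + dot (ev (u ord_max)) (advFlux c (u ord_max) + Phi c (u ord_max))
   - dot (ev (u ord0)) (advFlux c (u ord0) + Phi c (u ord0))
  = \sum_j \sum_k Q j k * entropyProd c f (u j) (u k)
    + (Psi (u ord_max) - Psi (u ord0)).
Proof.
move=> fC fE.
pose A j k := dot (ev (u j)) (f (u j) (u k)).
pose B j k := dot (ev (u j)) (PhiDiamond c (u j) (u k)).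
(* This removes the potentials at [j] and the [Phi] left over from [PhiStar]. *)
have row0 (w : 'I_N.+1 -> R) : \sum_j \sum_k Q j k * w j = 0.
  by apply: big1 => j _; rewrite -mulr_suml sum_Qmx_row ?mul0r.
have -> : \sum_j \sum_k Q j k * entropyProd c f (u j) (u k) =
    \sum_j \sum_k Q j k * A k j - \sum_j \sum_k Q j k * A j k
    + (\sum_j \sum_k Q j k * B k j - \sum_j \sum_k Q j k * B j k)
    - (\sum_j \sum_k Q j k * Psi (u k) - \sum_j \sum_k Q j k * Psi (u j)).
  rewrite -!sumrB -big_split -sumrB; apply: eq_bigr => j _ /=.
  rewrite -!sumrB -big_split -sumrB; apply: eq_bigr => k _ /=.
  rewrite /A /B (fC k j) entropyProdE.
  (* Scalar identities are stated for variables: on the entropy expressions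
     themselves [ring] compares atoms by unfolding and does not terminate. *)
  have alg (r x y z w p q : R) : r * (x - y + z - w - (p - q)) =
     r * x - r * y + (r * z - r * w) - (r * p - r * q) by ring.
  exact: alg.
rewrite (sum_Qmx_transpose A) (sum_Qmx_transpose B).
rewrite (sum_Qmx_transpose (fun j _ => Psi (u j))) row0.
have -> : \sum_j dot (ev (u j)) (- (2 *: \sum_k Q j k *: f (u j) (u k))
     - \sum_k Q j k *: PhiStar c (u j) (u k)) =
   - 2 * (\sum_j \sum_k Q j k * A j k) - 2 * (\sum_j \sum_k Q j k * B j k)
     + \sum_j \sum_k Q j k * dot (ev (u j)) (Phi c (u j)).
  rewrite !mulr_sumr -sumrB -big_split; apply: eq_bigr => j _ /=.
  have Phi2 k : dot (ev (u j)) (PhiStar c (u j) (u k)) =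
      2 * B j k - dot (ev (u j)) (Phi c (u j)).
    have /(canRL (addKr _)) -> := esym (PhiDiamond_half (u j) (u k)).
    rewrite /B; move: (ev _) (PhiDiamond c _ _) (Phi c _) => v P P'.
    by rewrite dotDr dotNr dotZr addrC.
  transitivity (- (2 * \sum_k Q j k * dot (ev (u j)) (f (u j) (u k)))
     - \sum_k Q j k * dot (ev (u j)) (PhiStar c (u j) (u k))).
    move: (ev (u j)) (fun k => f (u j) (u k)) => v F.
    move: (fun k => PhiStar c (u j) (u k)) => P.
    rewrite dotBr dotNr dotZr !dot_sumr.
    by congr (- (2 * _) - _); apply: eq_bigr => k _; rewrite dotZr.
  rewrite !mulr_sumr -!sumrN -!big_split; apply: eq_bigr => k _ /=.
  by rewrite Phi2 -/(A j k); ring.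
rewrite row0.
have diag j : dot (ev (u j)) (advFlux c (u j) + Phi c (u j)) = A j j + B j j.
  by rewrite /A /B fE PhiDiamond_diag dotDr.
have alg (SA SB a b d e x y P P' : R) : P = a + b -> P' = d + e ->
    - 2 * SA - 2 * SB + 0 + P - P' =
      a - d - SA - SA + (b - e - SB - SB) - (x - y - 0 - 0) + (x - y).
  by move=> -> ->; ring.
exact: alg (diag _) (diag _).
Qed.

End DG.

Section FV.
Variables (N : nat).

(** Regrouping the nodal sum by interfaces pairs the two contributions of each interface, one from
    either adjacent node. *)
Lemma FV_interface_entropy f (u : 'I_N.+1 -> state R) :
  (forall j k, f (u j) (u k) = f (u k) (u j)) ->
  \sum_(j < N.+1) dot (ev (u j))
     ((1 - (j == ord0)%:R) *: (f (u j) (u (inord j.-1))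
                       + PhiDiamond c (u j) (u (inord j.-1)))
    - (1 - (j == ord_max)%:R) *: (f (u j) (u (inord j.+1))
                       + PhiDiamond c (u j) (u (inord j.+1))))
  = \sum_(j < N) entropyProd c f (u (inord j)) (u (inord j.+1))
    + (Psi (u ord_max) - Psi (u ord0)).
Proof.
move=> fC.
pose T j k := dot (ev (u j)) (f (u j) (u k) + PhiDiamond c (u j) (u k)).
transitivity (\sum_(j < N.+1) (1 - (j == ord0)%:R) * T j (inord j.-1)
            - \sum_(j < N.+1) (1 - (j == ord_max)%:R) * T j (inord j.+1)).
  by rewrite -sumrB; apply: eq_bigr => j _; rewrite dotBr !dotZr.
(* The end terms, whose neighbour index is a default value, carry the factor 0; the remaining terms
   are indexed by the left node of the interface. *)
have -> : \sum_(j < N.+1) (1 - (j == ord0)%:R) * T j (inord j.-1) =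
    \sum_(j < N) T (inord j.+1) (inord j).
  rewrite big_ord_recl eqxx subrr mul0r add0r; apply: eq_bigr => j _.
  have -> : lift ord0 j = inord j.+1.
    by apply: val_inj; rewrite /= inordK // ltnS.
  by rewrite -val_eqE /= inordK ?ltnS // subr0 mul1r.
have -> : \sum_(j < N.+1) (1 - (j == ord_max)%:R) * T j (inord j.+1) =
    \sum_(j < N) T (inord j) (inord j.+1).
  rewrite big_ord_recr /= eqxx subrr mul0r addr0; apply: eq_bigr => j _.
  have -> : widen_ord (leqnSn N) j = inord j.
    by apply: val_inj; rewrite /= inordK // ltnS ltnW.
  rewrite -val_eqE /= inordK ?ltnS ?(ltnW (ltn_ord j)) //.
  by rewrite ltn_eqF // subr0 mul1r.
have -> : Psi (u ord_max) - Psi (u ord0) =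
    \sum_(j < N) (Psi (u (inord j.+1)) - Psi (u (inord j))).
  rewrite -(big_mkord xpredT
    (fun j => Psi (u (inord j.+1)) - Psi (u (inord j)))).
  rewrite (telescope_sumr (fun j => Psi (u (inord j)))) //.
  have -> : inord N = ord_max :> 'I_N.+1 by apply: val_inj; rewrite /= inordK.
  by have -> : inord 0 = ord0 :> 'I_N.+1 by apply: val_inj; rewrite /= inordK.
rewrite -sumrB -big_split; apply: eq_bigr => j _ /=.
exact: interface_entropy.
Qed.

End FV.
End EntropyBalance.

(** * Entropy balance of the two advective schemes *)

Section SchemeEntropy.
Variables (R : realType) (c : mhdParams R) (N : nat) (xi : nat -> R).
Variables (u : 'I_N.+1 -> state R) (uL uR : state R).
Implicit Types (f h : state R -> state R -> state R).

Local Notation ev := (entropyVars c).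

Lemma advDG_entropy f h : (0 < N)%N -> lglNodes N xi ->
  (forall j k, f (u j) (u k) = f (u k) (u j)) ->
  (forall j, f (u j) (u j) = advFlux c (u j)) ->
  h (u ord0) uL = h uL (u ord0) ->
  \sum_j dot (ev (u j)) (advDG c xi f h u uL uR j) =
    numEntropyFlux c h (u ord0) uL - numEntropyFlux c h (u ord_max) uR
    + 2^-1 * (entropyProd c h uL (u ord0) + entropyProd c h (u ord_max) uR)
    + \sum_j \sum_k Qmx xi j k * entropyProd c f (u j) (u k).
Proof.
move=> N_gt0 hxi fC fE hC.
have dot_split (v X Y p q r s : state R) (a b : R) :
    dot v (X - Y + a *: p - b *: q - a *: r + b *: s) =
    dot v (X - Y) + a * dot v p - b * dot v q - a * dot v r + b * dot v s.
  by rewrite !(dotDr, dotNr, dotZr).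
rewrite /advDG; under eq_bigr => j _ do rewrite dot_split.
rewrite ![in LHS](big_split, sumrN) /= !sum_pick.
rewrite (DG_volume_entropy N_gt0 hxi fC fE).
(* The potentials [PN] and [P0] left by the boundary fluxes cancel the difference coming from the
   volume terms. *)
have alg (S fN f0 rN r0 PN P0 b0 bN : R) :
    bN = fN - 2^-1 * rN + PN -> b0 = f0 + 2^-1 * r0 + P0 ->
    S + (PN - P0) - bN + b0 = f0 - fN + 2^-1 * (r0 + rN) + S.
  by move=> -> ->; field.
exact: alg (boundary_entropy_right c h _ _) (boundary_entropy_left c hC).
Qed.

(** The boundary contribution is the same expression as in [advDG_entropy], because both schemes
    share the element boundary flux; this is what lets them be blended. *)
Lemma advFV_entropy f h :
  (forall j k, f (u j) (u k) = f (u k) (u j)) ->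
  h (u ord0) uL = h uL (u ord0) ->
  \sum_j dot (ev (u j)) (advFV c f h u uL uR j) =
    numEntropyFlux c h (u ord0) uL - numEntropyFlux c h (u ord_max) uR
    + 2^-1 * (entropyProd c h uL (u ord0) + entropyProd c h (u ord_max) uR)
    + \sum_(j < N) entropyProd c f (u (inord j)) (u (inord j.+1)).
Proof.
move=> fC hC.
have dot_split (v p q r s : state R) (a b a' b' : R) :
    dot v (b *: s - a *: r + b' *: p - a' *: q) =
    b * dot v s - a * dot v r + dot v (b' *: p - a' *: q).
  by rewrite !(dotDr, dotNr, dotZr) addrA.
rewrite /advFV; under eq_bigr => j _ do rewrite dot_split.
rewrite ![in LHS](big_split, sumrN) /= !sum_pick.
rewrite FV_interface_entropy //.
have alg (S fN f0 rN r0 PN P0 b0 bN : R) :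
    bN = fN - 2^-1 * rN + PN -> b0 = f0 + 2^-1 * r0 + P0 ->
    b0 - bN + (S + (PN - P0)) = f0 - fN + 2^-1 * (r0 + rN) + S.
  by move=> -> ->; field.
exact: alg (boundary_entropy_right c h _ _) (boundary_entropy_left c hC).
Qed.

End SchemeEntropy.

(** * Entropy balance of the blended scheme *)

Theorem mainTheorem2 (R : realType) (c : mhdParams R) (hc : wfParams c)
    (N : nat) (hN : (1 <= N)%N) (xi : nat -> R) (hxi : lglNodes N xi)
    (J : R) (hJ : 0 < J) (alpha : R) (halpha : 0 <= alpha <= 1)
    (fstar fhat ffv : state R -> state R -> state R)
    (hstar : symmetricFlux c fstar /\ consistentFlux c fstar)
    (hhat : symmetricFlux c fhat /\ consistentFlux c fhat)
    (hfv : symmetricFlux c ffv /\ consistentFlux c ffv)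
    (u g : 'I_N.+1 -> R -> state R) (uL uR gL gR : R -> state R) (t : R)
    (hu : forall j, admissible c (u j t))
    (huL : admissible c (uL t)) (huR : admissible c (uR t))
    (hg : isGradient c xi J (u^~ t) (uL t) (uR t) (g^~ t))
    (hderiv : forall j, derivable (u j) t 1)
    (hscheme : forall j : 'I_N.+1,
      (J * lglWeight xi j) *: derive1 (u j) t =
        (1 - alpha) *: advDG c xi fstar fhat (u^~ t) (uL t) (uR t) j
        + alpha *: advFV c ffv fhat (u^~ t) (uL t) (uR t) j
        - diffDG c xi (u^~ t) (g^~ t) (uL t) (gL t) (uR t) (gR t) j) :
  \sum_(j < N.+1)
      J * lglWeight xi j * dot (entropyVars c (u j t)) (derive1 (u j) t)
  = numEntropyFlux c fhat (u ord0 t) (uL t)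
    - numEntropyFlux c fhat (u ord_max t) (uR t)
    + 2^-1 * (entropyProd c fhat (uL t) (u ord0 t)
              + entropyProd c fhat (u ord_max t) (uR t))
    + (1 - alpha) * (\sum_(j < N.+1) \sum_(k < N.+1)
        Qmx xi j k * entropyProd c fstar (u j t) (u k t))
    + alpha * (\sum_(j < N)
        entropyProd c ffv (u (inord j) t) (u (inord j.+1) t))
    + diffEntropyProd c xi (u^~ t) (g^~ t) (uL t) (gL t) (uR t) (gR t).
Proof.
have fstarC j k := hstar.1 _ _ (hu j) (hu k).
have fstarE j := hstar.2 _ (hu j).
have fhatC := hhat.1 _ _ (hu ord0) huL.
have ffvC j k := hfv.1 _ _ (hu j) (hu k).
have := advDG_entropy (u := u^~ t) (uR t) hN hxi fstarC fstarE fhatC.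
have := advFV_entropy c (u := u^~ t) (uR t) ffvC fhatC.
set FV := (\sum_j dot _ (advFV _ _ _ _ _ _ _)) => eFV.
set DG := (\sum_j dot _ (advDG _ _ _ _ _ _ _ _)) => eDG.
transitivity ((1 - alpha) * DG + alpha * FV
  + diffEntropyProd c xi (u^~ t) (g^~ t) (uL t) (gL t) (uR t) (gR t)).
  rewrite /diffEntropyProd !mulr_sumr -sumrN -!big_split.
  apply: eq_bigr => j _ /=; rewrite -dotZr hscheme.
  have dot_split (v p q r : state R) a b :
      dot v (a *: p + b *: q - r) = a * dot v p + b * dot v q - dot v r.
    by rewrite !(dotDr, dotNr, dotZr).
  exact: dot_split.
rewrite eDG eFV.
(* The weights [1 - alpha] and [alpha] sum to 1 on the common boundary contribution [x]. *)
have alg (x p q S T D : R) :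
  (1 - alpha) * (x + S) + alpha * (x + T) + D =
  x + (1 - alpha) * S + alpha * T + D by ring.
exact: alg.
Qed.
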